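(* Every $\mathbb{Q}$-factorial toric terminal $4$-dimensional singularity is a cyclic quotient. Explicitly: let $D\subset\mathbb{Q}^4$ be a lattice of rank $4$, let $\sigma\subset\mathbb{R}^4$ be a convex cone spanned by $4$ linearly independent elements of $D$, let $v_1,v_2,v_3,v_4\in D$ be the primitive generators of the four edges of $\sigma$, and let $D'=\mathbb{Z}v_1+\mathbb{Z}v_2+\mathbb{Z}v_3+\mathbb{Z}v_4$. If the singularity defined by $(D,\sigma)$ is terminal, then the finite abelian group $G=D/D'$ is cyclic.
   Context: A lattice of rank $4$ in $\mathbb{Q}^4$ is a subgroup generated by a $\mathbb{Q}$-basis of $\mathbb{Q}^4$. The edges of $\sigma$ are its one-dimensional faces (rays), and the primitive generator of an edge is the nonzero element $v$ of $D$ on it such that the intersection of the edge with $D$ is $\{kv : k\in\mathbb{Z}_{\ge 0}\}$. Thus $D'$ is the lattice spanned by the intersections of the edges of $\sigma$ with $D$. The affine toric variety $U_\sigma$ associated with $(D,\sigma)$ is a $\mathbb{Q}$-factorial toric quotient singularity $\mathbb{C}^4/G$ with $G=D/D'$ finite abelian acting diagonally. Every $\mathbb{Q}$-factorial toric $4$-dimensional singularity is of this form. It is called a cyclic quotient if $G$ is a cyclic group (the trivial group is allowed). Terminality is used through M. Reid's criterion: the singularity is terminal if and only if the simplex $$\left\{\sum_{i=1}^4 x_i v_i \;:\; x_i\ge 0 \text{ for all } i,\ \sum_{i=1}^4 x_i\le 1\right\},$$ i.e. the convex hull of $0,v_1,v_2,v_3,v_4$, meets $D$ only in its vertices $0,v_1,v_2,v_3,v_4$.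 *)

(* Defs.v *)
(* MathComp, with sets and real numbers from MathComp-Analysis. *)
From HB Require Import structures.
From mathcomp Require Import all_boot all_order all_algebra.
From mathcomp Require Import all_classical all_reals.

Set Implicit Arguments.
Unset Strict Implicit.
Unset Printing Implicit Defensive.

Import Order.TTheory GRing.Theory Num.Theory.
Local Open Scope classical_set_scope.
Local Open Scope ring_scope.

Definition zspan (n : nat) (b : 'I_n -> 'rV[rat]_n) : set 'rV[rat]_n :=
  [set \sum_i b i *~ c i | c in [set: 'I_n -> int]].

Definition is_lattice (n : nat) (D : set 'rV[rat]_n) : Prop :=
  exists2 b : 'I_n -> 'rV[rat]_n,
    basis_of {: 'rV[rat]_n} [tuple b i | i < n] & D = zspan b.

Definition realvec (R : realType) (n : nat) (x : 'rV[rat]_n) : 'rV[R]_n :=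
  map_mx ratr x.

Definition cone (R : realType) (n : nat) (w : 'I_n -> 'rV[rat]_n) :
    set 'rV[R]_n :=
  [set \sum_i a i *: realvec R (w i) | a in [set a | forall i, 0 <= a i]].

Definition is_simplicial_cone (R : realType) (n : nat)
    (D : set 'rV[rat]_n) (sigma : set 'rV[R]_n) : Prop :=
  exists w : 'I_n -> 'rV[rat]_n,
    [/\ forall i, D (w i), free [tuple w i | i < n] & sigma = cone w].

(* The column u is the linear form x |-> x *m u; a face is cut out of sigma by
   a linear form that is nonnegative on sigma. *)
Definition is_face (R : realType) (n : nat) (sigma F : set 'rV[R]_n) : Prop :=
  exists2 u : 'cV[R]_n,
    forall x, sigma x -> 0 <= (x *m u) 0 0 &
    F = [set x | sigma x /\ (x *m u) 0 0 = 0].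

(* The dimension of a face is that of its linear span. *)
Definition one_dimensional (R : realType) (n : nat) (F : set 'rV[R]_n) : Prop :=
  exists x, [/\ F x, x != 0 & forall y, F y -> exists a : R, y = a *: x].

Definition is_edge (R : realType) (n : nat) (sigma F : set 'rV[R]_n) : Prop :=
  is_face sigma F /\ one_dimensional F.

Definition is_primitive_generator (R : realType) (n : nat)
    (D : set 'rV[rat]_n) (F : set 'rV[R]_n) (v : 'rV[rat]_n) : Prop :=
  [/\ v != 0, D v, F (realvec R v) &
      [set x | D x /\ F (realvec R x)] = [set v *+ k | k in [set: nat]]].

(* E enumerates the edges of sigma without repetition; in particular there are
   exactly n of them. *)
Definition are_edge_generators (R : realType) (n : nat)
    (D : set 'rV[rat]_n) (sigma : set 'rV[R]_n)
    (v : 'I_n -> 'rV[rat]_n) : Prop :=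
  exists2 E : 'I_n -> set 'rV[R]_n,
    set_bij [set: 'I_n] [set F | is_edge sigma F] E &
    forall i, is_primitive_generator D (E i) (v i).

Definition simplex (R : realType) (n : nat) (v : 'I_n -> 'rV[rat]_n) :
    set 'rV[R]_n :=
  [set \sum_i a i *: realvec R (v i) |
     a in [set a | (forall i, 0 <= a i) /\ \sum_i a i <= 1]].

(* Reid's criterion for the singularity defined by the lattice D and the cone
   whose edges have the primitive generators v i. *)
Definition is_terminal (R : realType) (n : nat)
    (D : set 'rV[rat]_n) (v : 'I_n -> 'rV[rat]_n) : Prop :=
  [set x | D x /\ simplex v (realvec R x)] = 0 |` range v.

Definition coset (n : nat) (D' : set 'rV[rat]_n) (x : 'rV[rat]_n) :
    set 'rV[rat]_n :=
  [set x + y | y in D'].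

(* For subgroups D' of D, the k-th multiple of the class of g in D / D' is the
   class of g *~ k. *)
Definition is_cyclic_quotient (n : nat) (D D' : set 'rV[rat]_n) : Prop :=
  exists2 g, D g &
    forall x, D x -> exists k : int, coset D' x = coset D' (g *~ k).

(* Main.v *)
(* Suppose D / D' is not cyclic. The Smith normal form of D' in D yields n > 1
   and an injection of (Z/n)^2 into D / D'; let f_0, ..., f_3 : (Z/n)^2 -> Z/n
   be its coordinates with respect to the v i / n, and put
   f_4 = - (f_0 + ... + f_3).  Let A x be the sum of the representatives of the
   f_i x in [0, n[, a multiple of n.  Terminality gives A x >= 2n for x != 0.
   As A x + A (- x) is n times the number of nonzero f_i x, at most one f_i x
   vanishes and A x is 2n or 3n.  Hence every pair (f_i, f_j) with i != j is
   bijective, so the f_i are uniformly distributed and pairwise independent,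
   and the first two moments of A are explicit.  Since (A - 2n)(A - 3n)
   vanishes except at x = 0, where it is 6n^2, summing it over (Z/n)^2 gives
   n^2 = 1. *)
Require Import Defs.
From mathcomp Require Import all_boot all_order all_algebra.
From mathcomp Require Import all_classical all_reals.
From mathcomp Require Import perm zify ring lra.

Set Implicit Arguments.
Unset Strict Implicit.
Unset Printing Implicit Defensive.

Import Order.TTheory GRing.Theory Num.Theory.
Local Open Scope classical_set_scope.
Local Open Scope ring_scope.

(** * Moments of a sum of pairwise uniform coordinates *)

Lemma sum_ord_rat n : \sum_(k < n) (k%:R : rat) = n%:R * (n%:R - 1) / 2.
Proof.
elim: n => [|n IHn]; first by rewrite big_ord0 !mul0r.
by rewrite big_ord_recr /= IHn -natr1; field.
Qed.

Lemma sum_sqr_ord_rat n :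
  \sum_(k < n) (k%:R : rat) ^+ 2 = n%:R * (n%:R - 1) * (2 * n%:R - 1) / 6.
Proof.
elim: n => [|n IHn]; first by rewrite big_ord0 !mul0r.
by rewrite big_ord_recr /= IHn -natr1; field.
Qed.

Section PairwiseUniform.
Variables (n : nat) (T I : finType) (f : I -> T -> 'I_n).
Hypothesis cardT : #|T| = (n * n)%N.
Hypothesis f_inj : forall i j, i != j -> injective (fun x => (f i x, f j x)).

(** Since [T] has [n * n] elements, the injective map given by two distinct coordinates is a
    bijection onto all pairs. *)
Lemma sum_pairwise_uniform (V : nmodType) (F : 'I_n -> 'I_n -> V) i j :
  i != j -> \sum_x F (f i x) (f j x) = \sum_k \sum_l F k l.
Proof.
move=> /f_inj fij_inj; rewrite pair_bigA /=.
by rewrite (reindex _ (onW_bij _ (inj_card_bij fij_inj _))) //= card_prod card_ord cardT.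
Qed.

Hypothesis cardI : (1 < #|I|)%N.

Let m : rat := #|I|%:R.
Let N : rat := n%:R.
Let X x : rat := \sum_i (f i x)%:R.

Lemma sum_coord_pairwise_uniform (F : 'I_n -> rat) i :
  \sum_x F (f i x) = N * \sum_k F k.
Proof.
(* Uniformity of one coordinate is read off from a pair, so a second index is chosen. *)
have [j ij] : exists j, i != j.
  move: cardI; rewrite (cardD1 i) inE ltnS => /card_gt0P[j].
  by rewrite !inE andbT eq_sym; exists j.
rewrite (sum_pairwise_uniform (fun k _ => F k) ij) exchange_big /=.
by rewrite sumr_const card_ord mulr_natl.
Qed.

Lemma first_moment : \sum_x X x = m * N ^+ 2 * (N - 1) / 2.
Proof.
rewrite exchange_big /=.
under eq_bigr do rewrite (sum_coord_pairwise_uniform (fun k => k%:R)) sum_ord_rat.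
by rewrite sumr_const -mulr_natl -/m -/N; field.
Qed.

(** Expanding the square leaves [m] diagonal terms, governed by the sum of squares, and
    [m * (m - 1)] mixed terms, which factor by pairwise independence. *)
Lemma second_moment : \sum_x X x ^+ 2 =
  m * N ^+ 2 * (N - 1) * (2 * N - 1) / 6 +
  m * (m - 1) * (N * (N - 1) / 2) ^+ 2.
Proof.
under eq_bigr do rewrite expr2 mulr_suml; rewrite exchange_big /=.
rewrite (eq_bigr (fun=> N ^+ 2 * (N - 1) * (2 * N - 1) / 6 +
  (m - 1) * (N * (N - 1) / 2) ^+ 2)); last first.
  move=> i _; under eq_bigr do rewrite mulr_sumr; rewrite exchange_big /=.
  rewrite (bigD1 i) //=; congr (_ + _).
    rewrite (sum_coord_pairwise_uniform (fun k => k%:R * k%:R)).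
    by under eq_bigr do rewrite -expr2; rewrite sum_sqr_ord_rat -/N; field.
  rewrite (eq_bigr (fun=> (N * (N - 1) / 2) ^+ 2)); last first.
    move=> j ji; rewrite eq_sym in ji.
    rewrite (sum_pairwise_uniform (fun k l => k%:R * l%:R) ji).
    under eq_bigr do rewrite -mulr_sumr.
    by rewrite -mulr_suml sum_ord_rat expr2.
  rewrite sumr_const -[X in _ *+ X]/(#|predC1 i|) cardC1 -[LHS]mulr_natl.
  by congr (_ * _); rewrite /m; case: #|I| cardI => // k _; rewrite -natr1 addrK.
rewrite sumr_const -mulr_natl -/m; ring.
Qed.
End PairwiseUniform.

Lemma five_pairwise_uniform (n : nat) (T : finType) (f : 'I_5 -> T -> 'I_n)
    (z : T) :
  #|T| = (n * n)%N ->
  (forall i j, i != j -> injective (fun x => (f i x, f j x))) ->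
  (forall i, f i z = 0 :> nat) ->
  (forall x, x != z -> (\sum_i f i x = 2 * n \/ \sum_i f i x = 3 * n)%N) ->
  n = 1%N.
Proof.
move=> cardT f_inj fz0 age.
have n_gt0 : (0 < n)%N by apply: leq_ltn_trans (ltn_ord (f ord0 z)).
have cI : (1 < #|'I_5|)%N by rewrite card_ord.
pose N : rat := n%:R; pose X x : rat := \sum_i (f i x)%:R.
have sumE : \sum_x (X x - 2 * N) * (X x - 3 * N) = 6 * N ^+ 2.
  rewrite (bigD1 z) //= [X in _ + X]big1 => [|x /age].
    by rewrite /X big1 => [|i _]; [ring | rewrite fz0].
  by rewrite /X -natr_sum => -[->|->]; rewrite natrM subrr ?mul0r ?mulr0.
have : \sum_x (X x - 2 * N) * (X x - 3 * N) =
    \sum_x X x ^+ 2 - 5 * N * \sum_x X x + 6 * N ^+ 4.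
  rewrite mulr_sumr -sumrB; have -> : 6 * N ^+ 4 = \sum_(x : T) 6 * N ^+ 2.
    by rewrite sumr_const cardT -[RHS]mulr_natl natrM -/N; ring.
  by rewrite -big_split; apply: eq_bigr => x _ /=; ring.
rewrite sumE second_moment // first_moment // card_ord -/N => N_eq.
(* With five coordinates the moments evaluate the sum to [N ^+ 2 * (N ^+ 2 + 35) / 6], which has to
   equal [6 * N ^+ 2]. *)
have : N ^+ 2 * (N ^+ 2 - 1) = 0 by move: N_eq; lra.
have N_gt0 : N != 0 by rewrite pnatr_eq0 -lt0n.
move/eqP; rewrite mulf_eq0 expf_eq0 (negPf N_gt0) andbF /= subr_eq0 /N.
by rewrite -natrX -[1]/(1%:R) eqr_nat => /eqP; case: (n) => [|[]] //; lia.
Qed.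

(** * Sums of residues modulo n *)

Lemma modzN_add (n : nat) (x : int) : (0 < n)%N ->
  (x %% n)%Z + ((- x) %% n)%Z = ((x %% n)%Z != 0)%:R * n%:Z.
Proof.
move=> n_gt0; have n_neq0 : n%:Z != 0 by rewrite -lt0n.
have [x0|xN0] := eqVneq (x %% n)%Z 0.
  have /dvdz_mod0P : (n %| - x)%Z by rewrite rpredN; apply/dvdz_mod0P.
  by move->; rewrite x0 mul0r.
have r_ge0 := modz_ge0 x n_neq0; have r_lt := @ltz_pmod x n n_gt0.
have -> : - x = (- (x %/ n)%Z - 1) * n + (n%:Z - (x %% n)%Z).
  by rewrite {1}(divz_eq x n); ring.
rewrite modzMDl; move: (x %% n)%Z xN0 r_ge0 r_lt => r rN0 r_ge0 r_lt.
by rewrite modz_small ?mul1r; lia.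
Qed.

Lemma dvdz_sum_modz (n : int) (I : finType) (x : I -> int) :
  (n %| \sum_i (x i %% n)%Z)%Z = (n %| \sum_i x i)%Z.
Proof.
have -> : \sum_i x i = (\sum_i (x i %/ n)%Z) * n + \sum_i (x i %% n)%Z.
  by rewrite mulr_suml -big_split; apply: eq_bigr => i _; exact: divz_eq.
by rewrite rpredDl //; apply: dvdz_mull.
Qed.

(** The pairs (s, t) modulo n stand for (Z/n)^2. The lower bound is used at a pair and at its
    opposite to limit the number of zero residues; that limit, used at a difference of two pairs,
    gives injectivity. *)
Lemma five_residues_age (n : nat) (p q : 'I_5 -> int) :
  (0 < n)%N -> \sum_i p i = 0 -> \sum_i q i = 0 ->
  (forall s t : int, ~~ ((n %| s)%Z && (n %| t)%Z) ->
     (2 * n)%:Z <= \sum_i ((s * p i + t * q i) %% n)%Z) ->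
  n = 1%N.
Proof.
move=> n_gt0 p0 q0 age; have n_neq0 : n%:Z != 0 by rewrite -lt0n.
pose a (s t : int) i := ((s * p i + t * q i) %% n)%Z.
pose zeros (s t : int) := #|[pred i | a s t i == 0]|.
have a_ge0 s t i : 0 <= a s t i by apply: modz_ge0.
have a_lt s t i : a s t i < n by apply: ltz_pmod.
have a_pair s t : \sum_i a s t i + \sum_i a (- s) (- t) i =
    (5 - (zeros s t)%:Z) * n.
  rewrite -big_split /= (eq_bigr (fun i => (a s t i != 0)%:R * n%:Z)).
    rewrite -mulr_suml -natr_sum; congr (_ * _).
    have := cardC [pred i | a s t i == 0]; rewrite card_ord /zeros.
    rewrite -[#|[predC _]|]/(#|[pred i | a s t i != 0]|).
    have -> : (\sum_i (a s t i != 0) = #|[pred i | a s t i != 0]|)%N.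
      rewrite -sum1_card [RHS]big_mkcond; apply: eq_bigr => i _.
      by rewrite inE; case: eqP.
    rewrite natz => c5.
    by apply/eqP; rewrite eq_sym subr_eq eq_sym -PoszD addnC c5.
  by move=> i _; rewrite /a -(modzN_add _ n_gt0) !mulNr -opprD.
have zeros_le1 s t : ~~ ((n %| s)%Z && (n %| t)%Z) ->
    (zeros s t <= 1)%N /\ \sum_i a s t i <= (3 * n)%:Z.
  move=> st; have := age _ _ st; have := age (- s) (- t).
  rewrite !rpredN => /(_ st); rewrite -!/(a _ _ _) => le1 le2.
  have := a_pair s t; set S := \sum_i _ in le2 *; set S' := \sum_i _ in le1 *.
  (* With at most one zero, [S] is at most 5n minus the 2n taken by [S']. Two zeros would leave at
     most 3n for both sums, which need 4n. *)
  case: (zeros s t) => [|[|z]]; [lia | lia | move=> eqS; exfalso].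
  have : (5 - z.+2%:Z) * n <= 3 * n%:Z by rewrite ler_pM2r; lia.
  lia.
have dvd_sum s t : (n %| \sum_i a s t i)%Z.
  rewrite dvdz_sum_modz big_split /= -!mulr_sumr p0 q0 !mulr0 addr0.
  exact: dvdz0.
have small_dvd (k l : 'I_n) : (n %| k%:Z - l%:Z)%Z -> k = l.
  rewrite -eqz_mod_dvd !modz_small ?lez_nat ?ltz_nat ?ltn_ord // eqz_nat.
  by move=> /eqP/ord_inj.
(* [inord] needs a bound in successor form. *)
case: n => // n in p q n_gt0 n_neq0 p0 q0 age a zeros a_ge0 a_lt a_pair
  zeros_le1 dvd_sum small_dvd *.
pose f i (x : 'I_n.+1 * 'I_n.+1) : 'I_n.+1 := inord `|a x.1 x.2 i|.
have fE i x : f i x = a x.1 x.2 i :> int.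
  rewrite /f inordK ?gez0_abs //.
  by rewrite -ltz_nat gez0_abs.
apply: (@five_pairwise_uniform _ _ f (ord0, ord0)).
- by rewrite card_prod !card_ord.
- move=> i j ij [x1 x2] [y1 y2] [fi fj].
  (* Two points that agree in coordinates i and j have a difference with two zero residues, so they
     coincide. *)
  have zero k : f k (x1, x2) = f k (y1, y2) ->
      a (x1%:Z - y1%:Z) (x2%:Z - y2%:Z) k == 0.
    move/(congr1 (fun u : 'I_n.+1 => u%:Z)); rewrite !fE /= => /eqP.
    rewrite eqz_mod_dvd => /dvdz_mod0P/eqP; rewrite /a.
    by congr ((_ %% _)%Z == 0); ring.
  have [/andP[/small_dvd-> /small_dvd->] //|/zeros_le1[]] :=
    boolP ((n.+1 %| x1%:Z - y1%:Z)%Z && (n.+1 %| x2%:Z - y2%:Z)%Z).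
  rewrite leqNgt => /card_gt1P[]; exists i, j.
  by split=> //; rewrite inE zero.
- by move=> i; apply/eqP; rewrite -eqz_nat fE /a !mul0r mod0z.
- move=> [x1 x2] x_neq0.
  have x_ndvd : ~~ ((n.+1 %| x1%:Z)%Z && (n.+1 %| x2%:Z)%Z).
    apply: contra x_neq0 => /andP[dvd1 dvd2].
    rewrite (small_dvd x1 ord0) ?subr0 // (small_dvd x2 ord0) ?subr0 //.
  have sumE : (\sum_i f i (x1, x2))%N = \sum_i a x1 x2 i :> int.
    by rewrite -natz natr_sum; apply: eq_bigr => i _; rewrite natz fE.
  have [_ le3] := zeros_le1 _ _ x_ndvd; have ge2 := age _ _ x_ndvd.
  move: (dvd_sum x1 x2) le3 ge2; rewrite -/(\sum_i a x1 x2 i) -sumE dvdzE.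
  move=> /= /dvdnP[k ->]; rewrite !lez_nat !leq_pmul2r //.
  by case: k => [|[|[|[|]]]] //; [left | right].
Qed.

(** A fifth entry, minus the sum of the other four, makes each sum of residues a multiple of n
    without decreasing it; being above n, it is then at least 2n. *)
Lemma four_residues_age (n : nat) (p q : 'I_4 -> int) :
  (0 < n)%N ->
  (forall s t : int, ~~ ((n %| s)%Z && (n %| t)%Z) ->
     n%:Z < \sum_i ((s * p i + t * q i) %% n)%Z) ->
  n = 1%N.
Proof.
move=> n_gt0 age; have n_neq0 : n%:Z != 0 by rewrite -lt0n.
pose ext (r : 'I_4 -> int) i := oapp r (- \sum_j r j) (unlift ord0 i).
have ext0 r : ext r ord0 = - \sum_j r j by rewrite /ext unlift_none.
have extS r i : ext r (lift ord0 i) = r i by rewrite /ext liftK.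
have sum_ext r : \sum_i ext r i = 0.
  by rewrite big_ord_recl ext0 (eq_bigr _ (fun i _ => extS r i)) addNr.
apply: (@five_residues_age n (ext p) (ext q)) => // s t /age age_st.
set S := \sum_i _; have : (n %| S)%Z.
  by rewrite dvdz_sum_modz big_split /= -!mulr_sumr !sum_ext !mulr0 addr0 dvdz0.
have : n%:Z < S.
  rewrite /S big_ord_recl; under eq_bigr do rewrite !extS.
  by apply: (lt_le_trans age_st); rewrite lerDr modz_ge0.
move=> n_lt_S /dvdzP[k S_eq]; rewrite S_eq PoszM ler_pM2r //.
by move: n_lt_S; rewrite S_eq -[ltLHS]mul1r ltr_pM2r.
Qed.

(** * Lattices and cosets in coordinates *)

Definition rowmx (n : nat) (b : 'I_n -> 'rV[rat]_n) : 'M[rat]_n :=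
  \matrix_i b i.

Lemma mul_rowmx n (b : 'I_n -> 'rV[rat]_n) (u : 'rV_n) :
  u *m rowmx b = \sum_i u 0 i *: b i.
Proof. by rewrite mulmx_sum_row; apply: eq_bigr => i _; rewrite rowK. Qed.

Lemma zspanP n (b : 'I_n -> 'rV[rat]_n) x :
  zspan b x <-> exists c : 'rV[int]_n, x = map_mx intr c *m rowmx b.
Proof.
split=> [[c _ <-]|[c ->]].
  exists (\row_i c i); rewrite mul_rowmx; apply: eq_bigr => i _.
  by rewrite !mxE scaler_int.
exists (c 0) => //; rewrite mul_rowmx; apply: eq_bigr => i _.
by rewrite mxE scaler_int.
Qed.

Lemma zspanD n (b : 'I_n -> 'rV[rat]_n) x y :
  zspan b x -> zspan b y -> zspan b (x + y).
Proof.
move=> /zspanP[c ->] /zspanP[d ->]; apply/zspanP; exists (c + d).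
by rewrite map_mxD mulmxDl.
Qed.

Lemma zspanMz n (b : 'I_n -> 'rV[rat]_n) x (k : int) :
  zspan b x -> zspan b (x *~ k).
Proof.
move=> /zspanP[c ->]; apply/zspanP; exists (k *: c).
by rewrite map_mxZ -scalemxAl scaler_int.
Qed.

Lemma zspanN n (b : 'I_n -> 'rV[rat]_n) x : zspan b x -> zspan b (- x).
Proof. by move=> /(zspanMz (-1)); rewrite mulrN1z. Qed.

Lemma eq_coset n (b : 'I_n -> 'rV[rat]_n) x y :
  zspan b (x - y) -> coset (zspan b) x = coset (zspan b) y.
Proof.
move=> bxy; apply/seteqP; split=> _ [z bz <-].
  by exists (x - y + z); [exact: zspanD | rewrite addrA subrKC].
exists (- (x - y) + z); first by apply: zspanD => //; exact: zspanN.
by rewrite opprB addrA subrKC.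
Qed.

Lemma free_unitmx n (b : 'I_n -> 'rV[rat]_n) :
  free [tuple b i | i < n] -> rowmx b \in unitmx.
Proof.
move=> /freeP b_free; rewrite -row_free_unit; apply: inj_row_free => u u0.
apply/rowP => i; rewrite [RHS]mxE; apply: (b_free (u 0)) i.
rewrite -[RHS]u0 mul_rowmx; apply: eq_bigr => i _.
by rewrite -tnth_nth tnth_mktuple.
Qed.

(** * Terminality as a bound on residues *)

(** Such a point lies in the simplex, hence is a vertex; a vertex [v j] has a coordinate equal to 1,
    which the half-open box excludes. *)
Lemma terminal_box (R : realType) n (D : set 'rV[rat]_n)
    (v : 'I_n -> 'rV[rat]_n) (u : 'rV[rat]_n) :
  is_terminal R D v -> rowmx v \in unitmx -> D (u *m rowmx v) ->
  (forall i, 0 <= u 0 i < 1) -> \sum_i u 0 i <= 1 -> u = 0.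
Proof.
move=> term v_unit Du u01 u_le1.
have : [set x | D x /\ simplex v (realvec R x)] (u *m rowmx v).
  split=> //; exists (fun i => ratr (u 0 i)); first split.
  - by move=> i; rewrite ler0q; case/andP: (u01 i).
  - by move: u_le1; rewrite -(ler_rat R) rmorph_sum rmorph1.
  - rewrite mul_rowmx /realvec; apply/rowP => j; rewrite summxE [RHS]mxE summxE.
    by rewrite rmorph_sum; apply: eq_bigr => i _; rewrite !mxE rmorphM.
rewrite term => -[/= u0 | [j _ vj]].
  by rewrite -[u](mulmxK v_unit) u0 mul0mx.
have uj : u = delta_mx 0 j.
  by rewrite -[LHS](mulmxK v_unit) -vj -[v j](rowK v) rowE mulmxK.
by have := u01 j; rewrite uj mxE !eqxx ltxx andbF.
Qed.

(** The last hypothesis says that the classes of the two given points span a copy of (Z/n)^2 in D /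
    D'. Reducing the coordinates of a combination modulo n subtracts an element of D', so the
    reduced point stays in D and [terminal_box] applies to it. *)
Lemma terminal_pencil (R : realType) (b v : 'I_4 -> 'rV[rat]_4)
    (n : nat) (p q : 'rV[int]_4) :
  is_terminal R (zspan b) v -> rowmx v \in unitmx ->
  (forall i, zspan b (v i)) ->
  (0 < n)%N ->
  zspan b (n%:R^-1 *: (map_mx intr p *m rowmx v)) ->
  zspan b (n%:R^-1 *: (map_mx intr q *m rowmx v)) ->
  (forall s t : int, (forall i, (n %| s * p ord0 i + t * q ord0 i)%Z) ->
    (n %| s)%Z /\ (n %| t)%Z) ->
  n = 1%N.
Proof.
move=> term v_unit bv n_gt0 bp bq indep.
have n_neq0 : n%:Z != 0 by rewrite -lt0n.
have nQ_gt0 : 0 < n%:R :> rat by rewrite ltr0n.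
apply: (@four_residues_age n (p 0) (q 0)) => // s t st_ndvd.
rewrite ltNge; apply/negP => age_le; case/negP: st_ndvd; apply/andP.
apply: indep; pose x i := s * p 0 i + t * q 0 i.
pose u : 'rV[rat]_4 := \row_i (n%:R^-1 * (x i %% n)%Z%:~R).
have u0 : u = 0.
  apply: (terminal_box term v_unit).
  - have -> : u = (n%:R^-1 *: map_mx intr p) *~ s + (n%:R^-1 *: map_mx intr q) *~ t
               - map_mx intr (\row_i (x i %/ n)%Z).
      apply/rowP => i; rewrite -!scaler_int !mxE.
      have -> : (x i %% n)%Z = x i - (x i %/ n)%Z * n by rewrite /modz.
      rewrite rmorphB /= rmorphM /= /x rmorphD !rmorphM /=.
      by field; rewrite gt_eqF.
    have bvr : zspan b (map_mx intr (\row_i (x i %/ n)%Z) *m rowmx v).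
      rewrite mul_rowmx; elim/big_ind: _ => [|y z|i _].
      - by apply/zspanP; exists 0; rewrite map_mx0 mul0mx.
      - exact: zspanD.
      - by rewrite !mxE scaler_int; exact: zspanMz.
    rewrite mulmxBl mulmxDl -!scaler_int -!scalemxAl !scaler_int.
    by apply: zspanD; [apply: zspanD; exact: zspanMz | exact: zspanN].
  - move=> i; rewrite mxE mulr_ge0 ?invr_ge0 ?ler0z ?modz_ge0 ?ltW //=.
    by rewrite mulrC ltr_pdivrMr // mul1r -[n%:R]/(n%:Z%:~R) ltr_int ltz_pmod.
  - under eq_bigr do rewrite mxE; rewrite -mulr_sumr mulrC ler_pdivrMr // mul1r.
    by rewrite -rmorph_sum -[n%:R]/(n%:Z%:~R) ler_int.
move=> i; apply/dvdz_mod0P; have /eqP := congr1 (fun w : 'rV_4 => w 0 i) u0.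
by rewrite !mxE mulf_eq0 invr_eq0 gt_eqF //= intr_eq0 => /eqP.
Qed.

(** * Smith normal form and cyclicity *)

Lemma terminal_cyclic (R : realType) (b v : 'I_4 -> 'rV[rat]_4) :
  is_terminal R (zspan b) v -> rowmx v \in unitmx ->
  (forall i, zspan b (v i)) -> is_cyclic_quotient (zspan b) (zspan v).
Proof.
move=> term v_unit bv.
have [M vM] : exists M : 'M[int]_4, rowmx v = map_mx intr M *m rowmx b.
  have /choice[c vc] := fun i => (zspanP b (v i)).1 (bv i).
  exists (\matrix_i c i); apply/row_matrixP => i.
  by rewrite rowK vc row_mul -map_row rowK.
have [L L_unit [Q Q_unit [d d_sorted]]] := int_Smith_normal_form M.
set Delta := (\matrix_(i, j) _) => M_eq.
have Delta_diag : Delta = diag_mx (\row_i d`_i).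
  by apply/matrixP => i j; rewrite !mxE.
(* The [e k] form a basis of D adapted to D': by [eP], their multiples by the invariant factors form
   a basis of D'. *)
pose P := invmx L; pose e k := map_mx intr (row k Q) *m rowmx b.
have be k : zspan b (e k) by apply/zspanP; exists (row k Q).
have eP k : map_mx intr (row k P) *m rowmx v = (d`_k)%:~R *: e k.
  rewrite vM mulmxA -map_mxM -row_mul M_eq Delta_diag -!mulmxA mulKmx //.
  by rewrite row_mul row_diag_mx -scalemxAl -rowE mxE map_mxZ -scalemxAl.
have d_neq0 (i : 'I_4) : d`_i != 0.
  move: v_unit; rewrite vM unitmx_mul => /andP[+ _].
  rewrite unitmxE det_map_mx unitfE intr_eq0 M_eq !det_mulmx !mulf_eq0 !negb_or.
  rewrite Delta_diag det_diag => /andP[/andP[_ /prodf_neq0 /(_ i isT) di] _].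
  by move: di; rewrite mxE.
(* Reading past the end of [d] gives the default 0, so a nonzero entry at index 3 forces four
   entries. *)
have size_d : (3 < size d)%N.
  by rewrite ltnNge; apply: contra (d_neq0 ord_max) => le3; rewrite nth_default.
have d_dvd i j : (i <= j < 4)%N -> (d`_i %| d`_j)%Z.
  case/andP=> ij j4; apply: (sorted_leq_nth dvdz_trans dvdzz 0 d_sorted) => //;
    rewrite inE; lia.
pose i2 : 'I_4 := inord 2; have i2E : i2 = 2 :> nat by rewrite inordK.
pose i3 : 'I_4 := inord 3; have i3E : i3 = 3 :> nat by rewrite inordK.
(* The second largest invariant factor m is the largest integer such that
   (Z/m)^2 embeds into D / D'. *)
pose m := absz d`_2; have m1 : m = 1%N.
  have m_gt0 : (0 < m)%N by rewrite absz_gt0; have := d_neq0 i2; rewrite i2E.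
  have bk (k : 'I_4) : (2 <= k)%N ->
      zspan b (m%:R^-1 *: (map_mx intr (row k P) *m rowmx v)).
    move=> k_ge2; have /dvdzP[c d_c] : (m %| d`_k)%Z.
      by have := d_dvd 2 k; rewrite k_ge2 ltn_ord => /(_ isT).
    rewrite eP d_c scalerA rmorphM /= mulrC mulfK ?pnatr_eq0 -?lt0n //.
    by rewrite scaler_int; apply: zspanMz.
  apply: (terminal_pencil term v_unit bv m_gt0 (bk i2 _) (bk i3 _)).
  - by rewrite i2E.
  - by rewrite i3E.
  move=> s t dvd_st; pose x := s *: row i2 P + t *: row i3 P.
  (* Multiplying by [L] undoes [P] and exposes s and t as entries, while preserving divisibility by
     [m]. *)
  have xL : x *m L = s *: delta_mx 0 i2 + t *: delta_mx 0 i3.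
    by rewrite mulmxDl -!scalemxAl -!row_mul mulVmx // !row1.
  have dvd_xL j : (m %| (x *m L) ord0 j)%Z.
    rewrite mxE; apply: rpred_sum => i _; apply: dvdz_mulr.
    by move: (dvd_st i); rewrite !mxE.
  move: (dvd_xL i2) (dvd_xL i3).
  rewrite xL !mxE !eqxx -![i2 == _]val_eqE -![i3 == _]val_eqE /= i2E i3E.
  by rewrite !mulr1 !mulr0 addr0 add0r.
(* All terms of x in the basis [e] other than the one at [i3] lie in D', because their invariant
   factors divide a unit. *)
exists (e i3) => // _ /zspanP[c ->]; pose y := c *m invmx Q.
exists (y 0 i3); apply: eq_coset.
have -> : map_mx intr c *m rowmx b = \sum_i e i *~ y 0 i.
  have -> : c = \sum_i y 0 i *: row i Q by rewrite -mulmx_sum_row mulmxKV.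
  rewrite raddf_sum mulmx_suml.
  by apply: eq_bigr => i _; rewrite /= map_mxZ -scalemxAl scaler_int.
rewrite (bigD1 i3) //= addrAC subrr add0r.
elim/big_ind: _ => [|x z|i i_neq3].
- by apply/zspanP; exists 0; rewrite map_mx0 mul0mx.
- exact: zspanD.
(* As the invariant factor is 1 or -1, it is its own inverse: multiplying by it once more turns its
   multiple of [e i] into [e i]. *)
apply: zspanMz; apply/zspanP; exists (d`_i *: row i P).
rewrite map_mxZ -scalemxAl eP scalerA -rmorphM.
have : (d`_i %| d`_2)%Z.
  apply: d_dvd; move: i_neq3; rewrite -val_eqE /= i3E.
  by have := ltn_ord i; lia.
rewrite dvdzE -/m m1 dvdn1 => /eqP d_i1.
by have -> : d`_i * d`_i = 1 by [lia | nia]; rewrite scale1r.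
Qed.

(** * Edges of a simplicial cone *)

(** A form that is nonnegative on the cone and vanishes at a nonnegative combination vanishes at
    every generator occurring in it. Such a generator thus lies on the edge and spans it. *)
Lemma edge_cone (R : realType) n (w : 'I_n -> 'rV[rat]_n) (F : set 'rV[R]_n) :
  is_edge (cone w) F ->
  exists j, F = [set y | cone w y /\ exists a : R, y = a *: realvec R (w j)].
Proof.
case=> -[u u_ge0 ->] [_ [[[a a_ge0 <-] xu0] x_neq0 x_span]].
have [j awj] : exists j, a j *: realvec R (w j) != 0.
  apply/existsP; apply: contraNT x_neq0; rewrite negb_exists => /forallP aw0.
  by rewrite big1 // => i _; apply/eqP; move: (aw0 i); rewrite negbK.
have cone_w i : cone w (realvec R (w i)).
  exists (fun k => (k == i)%:R); first by move=> k; exact: ler0n.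
  by rewrite (bigD1 i) //= eqxx scale1r big1 ?addr0 // => k /negPf->; rewrite scale0r.
have wju : (realvec R (w j) *m u) 0 0 = 0.
  move: xu0; rewrite mulmx_suml summxE => /eqP; rewrite psumr_eq0 => [|i _].
    move=> /allP/(_ j (mem_index_enum _)); rewrite -scalemxAl mxE mulf_eq0.
    by case/orP=> /eqP // aj0; rewrite aj0 scale0r eqxx in awj.
  by rewrite -scalemxAl mxE mulr_ge0 ?a_ge0 // u_ge0.
have [c wj] := x_span _ (conj (cone_w j) wju).
have c_neq0 : c != 0.
  by apply: contraNneq awj => c0; rewrite wj c0 scale0r scaler0.
exists j; apply/seteqP; split=> y [cone_y].
  move=> yu; have [k y_eq] := x_span _ (conj cone_y yu); split=> //.
  by exists (k / c); rewrite y_eq wj scalerA divfK.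
by case=> k y_eq; split=> //; rewrite y_eq -scalemxAl mxE wju mulr0.
Qed.

(** Each [v i] is a nonzero multiple of some [w (pi i)], and distinct edges give distinct indices.
    So the two matrices differ by a permutation and an invertible diagonal factor. *)
Lemma edge_generators_unitmx (R : realType) n (D : set 'rV[rat]_n)
    (sigma : set 'rV[R]_n) (v : 'I_n -> 'rV[rat]_n) :
  is_simplicial_cone D sigma -> are_edge_generators D sigma v ->
  rowmx v \in unitmx.
Proof.
case=> w [_ /free_unitmx w_unit ->] [E [E_edge E_inj _] v_gen].
have /choice[pi E_pi] : forall i, exists j,
    E i = [set y | cone w y /\ exists a : R, y = a *: realvec R (w j)].
  by move=> i; apply: edge_cone; exact: E_edge.
have pi_inj : injective pi.
  by move=> i j pi_ij; apply: E_inj; rewrite ?inE // !E_pi pi_ij.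
have /choice[a v_a] : forall i, exists a : R, realvec R (v i) = a *: realvec R (w (pi i)).
  by move=> i; have [_ _ + _] := v_gen i; rewrite E_pi => -[_].
have a_neq0 i : a i != 0.
  have [v_neq0 _ _ _] := v_gen i; apply: contraNneq v_neq0 => a0.
  by rewrite -(map_mx_eq0 (@ratr R)) -[map_mx _ _]/(realvec R (v i)) v_a a0 scale0r.
(* The factors [a i] are given only as reals, so invertibility is checked over [R]. *)
rewrite -(map_unitmx (@ratr R)).
have -> : map_mx ratr (rowmx v) =
    diag_mx (\row_i a i) *m (perm_mx (perm pi_inj) *m map_mx (@ratr R) (rowmx w)).
  apply/row_matrixP => i; rewrite -map_row rowK -[LHS]/(realvec R (v i)) v_a.
  rewrite row_mul row_diag_mx -scalemxAl -rowE mxE -row_permE.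
  by congr (_ *: _); apply/rowP => j; rewrite !mxE permE.
rewrite !unitmx_mul unitmx_perm map_unitmx w_unit !andbT unitmxE det_diag unitfE.
by apply/prodf_neq0 => i _; rewrite mxE.
Qed.

Theorem theorem1 (R : realType)
    (D : set 'rV[rat]_4) (sigma : set 'rV[R]_4) (v : 'I_4 -> 'rV[rat]_4) :
  is_lattice D ->
  is_simplicial_cone D sigma ->
  are_edge_generators D sigma v ->
  is_terminal R D v ->
  is_cyclic_quotient D (zspan v).
Proof.
move=> [b _ ->] simp gens term; apply: (terminal_cyclic term).
  exact: edge_generators_unitmx simp gens.
by case: gens => E _ v_gen i; case: (v_gen i).
Qed.
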